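(* Let $D\subset\mathbb{R}$ be an arbitrary set and $f:D\rightarrow\mathbb{R}$ an arbitrary function. For almost every $x\in D$ there is a sequence $(x_k)_{k\in\mathbb{N}}\subset D$ such that, with $C=\{x\}\cup\{x_k:k\in\mathbb{N}\}$, the point $x$ is a limit point of $C$ and the derivative $(f_{|C})'(x)$ exists and is finite.
   Context: ''Measure'' means Lebesgue outer measure; neither $D$ nor $f$ is assumed measurable. ''For almost every $x\in D$'' means: for all $x\in D$ outside a subset of Lebesgue outer measure zero. For a set $C\subset D$ having $x\in C$ as a limit point, $(f_{|C})'(x)$ denotes the limit of $\frac{f(x')-f(x)}{x'-x}$ as $x'\rightarrow x$ with $x'\in C\setminus\{x\}$. *)

(* Defs.v *)
From mathcomp Require Export all_boot all_order all_algebra.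
From mathcomp Require Export all_classical all_reals topology normedtype.
From mathcomp Require Export measure lebesgue_measure.
Export Order.TTheory GRing.Theory Num.Theory.
Export numFieldNormedType.Exports.

Set Implicit Arguments.
Unset Strict Implicit.
Unset Printing Implicit Defensive.

Local Open Scope classical_set_scope.
Local Open Scope ring_scope.

(* Infimum of the total length of the countable covers by intervals ]a, b];
   defined for all sets of reals, measurable or not.  The library's
   [negligible_outer_measure] relates its null sets to those of
   [lebesgue_measure]. *)
Definition lebesgue_outer_measure {R : realType} (A : set R) : \bar R :=
  ((wlength (@idfun R))^* A)%mu.

Definition ae_in {R : realType} (D : set R) (P : R -> Prop) : Prop :=
  exists N : set R,
    [/\ N `<=` D, lebesgue_outer_measure N = 0%E
      & forall x, D x -> ~ N x -> P x].

(* [(f_{|C})'(x) = l].  Only the values of [f] at [x] and on [C] matter, so a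
   function on a superset D of [C] may be given by any total extension.  If [x] is not a limit point of [C] the filter is trivial and this holds for
   every [l], so it must be used together with [limit_point C x]. *)
Definition is_derive_within {R : realType} (f : R -> R) (C : set R) (x l : R)
    : Prop :=
  (fun y => (f y - f x) / (y - x)) @ within C x^' --> l.

(* Main.v *)
(* If x has points of D arbitrarily close to it with bounded difference
   quotients, a subsequence of these points has convergent quotients
   (Bolzano-Weierstrass).  Otherwise x lies in the set N where, for every c,
   |f y - f x| >= c |y - x| for all y in D within some distance h = h(c) of x
   (this includes the isolated points of D).  Taking c = 1, N is a countable
   union of pieces E on which f is bounded and does not contract distances, so
   that f has on E a 1-Lipschitz inverse g with bounded domain.  As g has
   derivative 0, E is null: for fixed c, the part of E where h(c) >= 1 / m.+1 is
   covered by finitely many intervals of total length at most C / c, and these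
   parts increase to E with m.  A liminf of measurable covers replaces the
   continuity of the outer measure along increasing nonmeasurable sets. *)
Require Import Defs.
From mathcomp Require Import interval_inference sequences ring lra.

Set Implicit Arguments.
Unset Strict Implicit.
Unset Printing Implicit Defensive.

Local Open Scope classical_set_scope.
Local Open Scope ring_scope.

Definition steep (R : realType) (f : R -> R) (D : set R) (c h : R) : set R :=
  [set x | D x /\
    forall y, D y -> `|y - x| < h -> c * `|y - x| <= `|f y - f x|].

(** After scaling by [m.+1], both numbers lie in one interval [[k, k + 1[]. This serves to cut both
    the range of [f] and the line into cells. *)
Lemma truncn_eq_dist (R : realType) (m : nat) (a b : R) : 0 <= a -> 0 <= b ->
  Num.truncn (a * m.+1%:R) = Num.truncn (b * m.+1%:R) ->
  `|a - b| < m.+1%:R^-1.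
Proof.
move=> a0 b0 ab.
have m0 : 0 < m.+1%:R :> R by [].
have := truncn_itv (mulr_ge0 a0 (ltW m0)).
have := truncn_itv (mulr_ge0 b0 (ltW m0)).
rewrite -ab -[(Num.truncn _).+1%:R]natr1 => /andP[b1 b2] /andP[a1 a2].
rewrite -[ltRHS]mul1r ltr_pdivlMr//.
rewrite -[X in _ * X](gtr0_norm m0) -normrM mulrBl.
by rewrite ltr_norml; apply/andP; split; lra.
Qed.

(* Cut the range of [f] into intervals of length [h = 1 / m.+1].  As [f] does
   not contract distances, the preimage of such an interval has diameter less
   than [h], hence at most [h / c] by steepness. *)
Lemma steep_cover (R : realType) (f : R -> R) (E : set R) (c : R) (K m : nat) :
  0 < c ->
  (forall x y, E x -> E y -> `|y - x| <= `|f y - f x|) ->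
  E `<=` steep f E c m.+1%:R^-1 ->
  (forall x, E x -> `|f x| <= K%:R) ->
  exists H : set (measurableTypeR R), [/\ measurable H, E `<=` H
    & (lebesgue_measure H <= ((4 * K%:R + 2) / c)%:E)%E].
Proof.
move=> c0 expE stE fK.
set h : R := m.+1%:R^-1.
have m0 : 0 < m.+1%:R :> R by [].
have h0 : 0 < h by rewrite invr_gt0.
have fK0 x : E x -> 0 <= f x + K%:R.
  by move=> /fK; rewrite ler_norml => /andP[? _]; lra.
pose index x := Num.truncn ((f x + K%:R) * m.+1%:R).
(* As [f x + K] lies in [[0, 2K]], indices run from 0 to [2 * K * m.+1] inclusive. *)
pose n := (2 * K * m.+1).+1%N.
have piece i : exists a : R, forall x, E x -> index x = i ->
    x \in `[a - h / c, a + h / c].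
  have [[a [Ea ai]]|noa] := pselect (exists a, E a /\ index a = i); last first.
    (* An empty piece gets the arbitrary centre 0. *)
    by exists 0 => x Ex xi; case: noa; exists x.
  exists a => x Ex xi.
  have fxa : `|f x - f a| < h.
    have -> : f x - f a = (f x + K%:R) - (f a + K%:R) by ring.
    apply: truncn_eq_dist; [exact: fK0|exact: fK0|].
    by rewrite -/(index x) -/(index a) xi.
  have xa : `|x - a| < h by exact: le_lt_trans (expE _ _ Ea Ex) fxa.
  have := (stE _ Ea).2 x Ex xa => cxa.
  have : `|x - a| <= h / c.
    by rewrite ler_pdivlMr// mulrC (le_trans cxa) ?ltW.
  by rewrite in_itv/= ler_norml => /andP[? ?]; apply/andP; split; lra.
have [a aP] := choice piece.
pose F i : set (measurableTypeR R) := `[a i - h / c, a i + h / c]%classic.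
have mF i : measurable (F i) by exact: measurable_itv.
have mH : measurable (\big[setU/set0]_(i < n) F i).
  by apply: bigsetU_measurable => i _.
exists (\big[setU/set0]_(i < n) F i); split => //.
- move=> x Ex; rewrite -bigcup_mkord; exists (index x); last exact: aP.
  rewrite /= /n truncn_lt_nat; last by rewrite mulr_ge0// fK0.
  rewrite -[ltRHS]natr1 2!natrM; apply: (@le_lt_trans _ _ (2 * K%:R * m.+1%:R)).
    rewrite ler_pM2r//.
    by have := fK _ Ex; rewrite ler_norml => /andP[_ ?]; lra.
  by rewrite ltrDl.
- have nhc : n%:R * (2 * (h / c)) <= (4 * K%:R + 2) / c.
    rewrite !mulrA ler_pM2r ?invr_gt0// /n -[X in X * 2]natr1 2!natrM /h.
    have -> : (2 * K%:R * m.+1%:R + 1) * 2 / m.+1%:R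
        = 4 * K%:R + 2 / m.+1%:R :> R.
      by field; rewrite addrC natr1 pnatr_eq0.
    by rewrite lerD2l ler_pdivrMr// ler_peMr// ler1n.
  apply: (@le_trans _ _ (\sum_(i < n) lebesgue_measure (F i))%E).
    exact: content_subadditive.
  have muF i : lebesgue_measure (F i) = (2 * (h / c))%:E.
    rewrite lebesgue_measure_itv/= lte_fin.
    have hc : 0 < h / c by rewrite divr_gt0.
    by rewrite ifT -?EFinB; [congr _%:E; ring|lra].
  under eq_bigr do rewrite muF.
  by rewrite sumEFin lee_fin sumr_const card_ord -[leLHS]mulr_natl.
Qed.

(** The inner intersections increase with [n] and the [n]-th lies in [F n], so continuity from below
    preserves the bound. *)
Lemma measure_liminf_le d (T : measurableType d) (R : realType)
    (mu : {measure set T -> \bar R}) (F : (set T)^nat) (b : \bar R) :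
  (forall n, measurable (F n)) -> (forall n, mu (F n) <= b)%E ->
  (mu (\bigcup_n \bigcap_(m in [set m | n <= m]%N) F m) <= b)%E.
Proof.
move=> mF Fb.
pose G n := \bigcap_(m in [set m | n <= m]%N) F m.
have mG n : measurable (G n) by exact: bigcap_measurableType.
have ndG : {homo G : n m / (n <= m)%N >-> (n <= m)%O}.
  move=> n m nm; apply/subsetPset => x Gx k /= mk.
  exact/Gx/(leq_trans nm).
apply: cvge_to_le (nondecreasing_cvg_mu mG (bigcupT_measurable _ mG) ndG) _.
apply: nearW => n /=; apply: le_trans (Fb n).
by apply: le_measure; rewrite ?inE// => x; apply; rewrite /=.
Qed.

Lemma steep_negligible (R : realType) (f : R -> R) (E : set R) (K : nat) :
  (forall x y, E x -> E y -> `|y - x| <= `|f y - f x|) ->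
  (forall x, E x -> `|f x| <= K%:R) ->
  (forall (c : nat) x, E x -> exists m : nat, steep f E c%:R m.+1%:R^-1 x) ->
  (@lebesgue_measure R).-negligible E.
Proof.
move=> expE fK stE.
have cover (p : nat * nat) : exists H : set (measurableTypeR R),
    [/\ measurable H, E `&` steep f E p.1.+1%:R p.2.+1%:R^-1 `<=` H
      & (lebesgue_measure H <= ((4 * K%:R + 2) / p.1.+1%:R)%:E)%E].
  apply: (@steep_cover _ f _ _ _ p.2) => //.
  - by move=> x y [Ex _] [Ey _]; exact: expE.
  - move=> x Ax; split=> // y [Ey _]; case: Ax => _ [_]; exact.
  - by move=> x [/fK].
have {cover} [H HP] := choice cover.
(* Steepness persists at smaller radii, so each point of [E] is in [H (c, m)] for all large [m]; the
   bound on these covers does not depend on [m]. *)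
pose G c := \bigcup_n \bigcap_(m in [set m | n <= m]%N) H (c, m).
have mG c : measurable (G c).
  apply: bigcupT_measurable => n; apply: bigcap_measurableType => m _.
  by have [] := HP (c, m).
exists (\bigcap_c G c); split.
- exact: bigcapT_measurable.
- apply/eqP; rewrite eq_le measure_ge0 andbT.
  apply/lee_addgt0Pr => e e0; rewrite add0e.
  (* Chosen so that [(4K + 2) / c.+1 < e]. *)
  pose c := Num.truncn ((4 * K%:R + 2) / e).
  apply: (@le_trans _ _ (lebesgue_measure (G c))).
    apply: le_measure; rewrite ?inE//; first exact: bigcapT_measurable.
    by move=> x; exact.
  apply: (@le_trans _ _ ((4 * K%:R + 2) / c.+1%:R)%:E).
    by apply: measure_liminf_le => m; have [] := HP (c, m).
  rewrite lee_fin ler_pdivrMr// -ler_pdivrMl// mulrC ltW//.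
  have /truncn_itv/andP[] // : 0 <= (4 * K%:R + 2) / e.
  by rewrite divr_ge0 ?addr_ge0 ?mulr_ge0// ltW.
- move=> x Ex c _; have [n [_ xn]] := stE c.+1 x Ex.
  exists n => // m /= nm; have [_ + _] := HP (c, m); apply.
  split=> //; split=> // y Ey yx; apply: xn => //.
  by rewrite (lt_le_trans yx)// lef_pV2 ?posrE// ler_nat.
Qed.

Lemma infinite_quotient_negligible (R : realType) (f : R -> R) (D : set R) :
  (@lebesgue_measure R).-negligible
    [set x | forall c : nat, exists m : nat, steep f D c%:R m.+1%:R^-1 x].
Proof.
set N := [set x | _].
(* Fixing [j] puts any two points of a piece within [1 / m.+1] of each other, where steepness with
   constant 1 applies. The bound on [x] makes [x + K] nonnegative, as truncation requires. *)
pose E (m K j : nat) := N `&` steep f D 1 m.+1%:R^-1 `&`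
  [set x | [/\ `|x| <= K%:R, `|f x| <= K%:R
             & Num.truncn ((x + K%:R) * m.+1%:R) = j]].
suff : (@lebesgue_measure R).-negligible
    (\bigcup_m \bigcup_K \bigcup_j E m K j).
  apply: negligibleS.
  move=> x Nx; have [m xm] := Nx 1%N; exists m => //.
  exists (Num.truncn (Num.max `|x| `|f x|)).+1 => //.
  have : Num.max `|x| `|f x| <= (Num.truncn (Num.max `|x| `|f x|)).+1%:R.
    have /truncn_itv/andP[_ /ltW//] : 0 <= Num.max `|x| `|f x|.
    by rewrite le_max normr_ge0.
  set K := (Num.truncn _).+1; rewrite ge_max => /andP[xK fxK].
  by exists (Num.truncn ((x + K%:R) * m.+1%:R)).
do 3!apply: negligible_bigcup => ?.
move: (X in E X) (X in E _ X) (X in E _ _ X) => m K j.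
apply: (@steep_negligible _ f _ K).
- move=> x y [[_ [Dx xm]] [xK _ xj]] [[_ [Dy _]] [yK _ yj]].
  rewrite -[leLHS]mul1r; apply: xm => //.
  have -> : y - x = (y + K%:R) - (x + K%:R) by ring.
  apply: truncn_eq_dist; last by rewrite xj yj.
    by move: yK; rewrite ler_norml => /andP[? _]; lra.
  by move: xK; rewrite ler_norml => /andP[? _]; lra.
- by move=> x [_ []].
- move=> c x Ex; have [n [_ xn]] := Ex.1.1 c.
  by exists n; split=> // y [[_ [Dy _]] _]; exact: xn.
Qed.

Lemma bounded_quotient_derive_within (R : realType) (f : R -> R) (D : set R)
    (x c : R) (y : nat -> R) :
  (forall m, D (y m)) -> (forall m, y m != x) -> y @ \oo --> x ->
  (forall m, `|f (y m) - f x| <= c * `|y m - x|) ->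
  exists u : nat -> R, (forall k, D (u k)) /\
    let C := [set x] `|` range u in
    limit_point C x /\ exists l : R, is_derive_within f C x l.
Proof.
move=> Dy yx ycvg fy.
pose q z := (f z - f x) / (z - x).
have qc m : q (y m) \in `[- c, c].
  rewrite in_itv/= -ler_norml normrM normfV ler_pdivrMr//.
  by rewrite normr_gt0 subr_eq0.
(* The quotients stay in a compact interval, so they converge to a cluster point along increasing
   indices [s]. *)
have [l [_ /cluster_eventually_cvg[s s_incr ql]]] :
    exists l, (`[- c, c] `&` cluster (q \o y @ \oo)) l.
  by apply: segment_compact; exists 0%N => // m _; exact: qc.
have ges n : (n <= s n)%N.
  elim: n => // n /leq_ltn_trans; apply.
  by move/increasing_seqP: s_incr => /(_ n); rewrite ltEnat.
have s_oo : s @ \oo --> \oo.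
  by move=> A [n _ nA]; exists n => // m /= nm; exact/nA/(leq_trans nm).
pose u := y \o s.
have ucvg : u @ \oo --> x by exact: cvg_comp ycvg.
exists u; split=> [k|]; first exact: Dy.
split.
  move=> U /ucvg[k _ kU]; exists (u k); split; [exact: yx|by right; exists k|].
  by apply: kU => /=.
exists l => U /ql[k _ kU].
(* The finitely many [u i] with [i < k] stay away from [x], so only the tail of
   [u] matters. *)
have far (j : nat) : \forall z \near x, forall i, (i < j)%N -> z <> u i.
  elim: j => [|j IH]; first by near=> z => i; rewrite ltn0.
  have xj : \forall z \near x, z != u j.
    apply: open_nbhs_nbhs; split; first exact: open_neq.
    by rewrite /= eq_sym; exact: yx.
  near=> z => i; rewrite ltnS leq_eqVlt => /predU1P[->|].
    by apply/eqP; near: z.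
  by move: i; near: z.
suff : \forall z \near x, z != x -> ([set x] `|` range u) z -> U (q z) by [].
near=> z => zx [zx'|[i _ uiz]]; first by rewrite zx' eqxx in zx.
have zu : forall i, (i < k)%N -> z <> u i by near: z; exact: far.
rewrite -uiz; apply: kU => /=; rewrite leqNgt; apply/negP => /zu.
by rewrite uiz.
Unshelve. all: by end_near.
Qed.

Theorem corollary1 (R : realType) (D : set R) (f : R -> R) :
  ae_in D (fun x : R =>
    exists u : nat -> R,
      (forall k, D (u k)) /\
      let C := [set x] `|` range u in
      limit_point C x /\ exists l : R, is_derive_within f C x l).
Proof.
have negN := infinite_quotient_negligible f D.
eexists; split; [|apply/negligible_outer_measure; exact: negN|].
  (* Steepness at [x] includes [D x], so any one constant will do. *)
  by move=> x /(_ 0%N)[m []].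
move=> x Dx /existsNP[c noc].
(* The strict inequality also forces [y] to differ from [x]. *)
have yP (m : nat) : exists y, [/\ D y, `|y - x| < m.+1%:R^-1
    & `|f y - f x| < c%:R * `|y - x|].
  apply: contrapT => noy; apply: noc; exists m; split=> // y Dy yx.
  by rewrite leNgt; apply/negP => fy; apply: noy; exists y.
have [y {}yP] := choice yP.
apply: (@bounded_quotient_derive_within _ f D x c%:R y).
- by move=> m; have [] := yP m.
- move=> m; apply/eqP => ym; have [_ _] := yP m.
  by rewrite ym !subrr normr0 mulr0 ltxx.
- apply/cvgrPdist_lt => _/posnumP[e]; near=> m; rewrite distrC.
  have [_ + _] := yP m; move=> /lt_trans; apply.
  by near: m; exact: near_infty_natSinv_lt.
- by move=> m; have [_ _ /ltW] := yP m.
Unshelve. all: by end_near.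
Qed.
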